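(* Let $\boldsymbol\xi_1,\dots,\boldsymbol\xi_N\in\mathbb R^d$, let $n_0$ be a nonnegative integer and $n_1,\dots,n_K$ positive integers with $\sum_{k=0}^K n_k=N$. Then $$\min\mathcal R^{\mathrm o}_{\mathrm{LP}}\ \le\ \min\mathcal R^{\mathrm o}_{\mathrm{SDP}}\ \le\ \min\mathcal P^{\mathrm o},$$ where $\mathcal P^{\mathrm o}$, $\mathcal R^{\mathrm o}_{\mathrm{SDP}}$ and $\mathcal R^{\mathrm o}_{\mathrm{LP}}$ are the optimization problems defined in the context.
   Context: Let $\mathbf D\in\mathbb S^N$ be the matrix with entries $d_{ij}=\|\boldsymbol\xi_i-\boldsymbol\xi_j\|^2$ (Euclidean norm), $\mathbb S^N$ the symmetric $N\times N$ matrices, $\langle\mathbf A,\mathbf B\rangle=\mathrm{Tr}(\mathbf A\mathbf B)$, $\mathbf 1$ the all-ones vector, $\mathrm{diag}(\mathbf A)$ the vector of diagonal entries of $\mathbf A$. $\mathbf A\succeq\mathbf B$ means $\mathbf A-\mathbf B$ is positive semidefinite; $\mathbf A\ge\mathbf B$ and $\mathbf A\le\mathbf B$ are elementwise. Problem $\mathcal P^{\mathrm o}$ (joint outlier detection and cardinality-constrained clustering, with outlier cluster $k=0$): minimize $\frac12\sum_{k=1}^K\frac1{n_k}\sum_{i,j=1}^N d_{ij}\eta_{ij}^k$ over $\pi_i^k\in\{0,1\}$, $\eta_{ij}^k\in\mathbb R_+$ ($i,j=1,\dots,N$, $k=0,\dots,K$) subject to $\sum_{i=1}^N\pi_i^k=n_k$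 for $k=0,\dots,K$, $\sum_{k=0}^K\pi_i^k=1$ for all $i$, and $\eta_{ij}^k\ge\pi_i^k+\pi_j^k-1$ for all $i,j$ and $k=0,\dots,K$. For an integer $n\ge0$, $\mathcal C_{\mathrm{SDP}}(n)$ is the set of all $(\boldsymbol x,\mathbf M)\in\mathbb R^N\times\mathbb S^N$ such that (i) $\mathbf 1^\top\boldsymbol x=2n-N$, $\mathbf M\mathbf 1=(2n-N)\boldsymbol x$, $\mathrm{diag}(\mathbf M)=\mathbf 1$; (ii) $\mathbf M\succeq\boldsymbol x\boldsymbol x^\top$; (iii) $\mathbf M+\mathbf 1\mathbf 1^\top+\boldsymbol x\mathbf 1^\top+\mathbf 1\boldsymbol x^\top\ge\mathbf 0$, $\mathbf M+\mathbf 1\mathbf 1^\top-\boldsymbol x\mathbf 1^\top-\mathbf 1\boldsymbol x^\top\ge\mathbf 0$, $\mathbf M-\mathbf 1\mathbf 1^\top+\boldsymbol x\mathbf 1^\top-\mathbf 1\boldsymbol x^\top\le\mathbf 0$, $\mathbf M-\mathbf 1\mathbf 1^\top-\boldsymbol x\mathbf 1^\top+\mathbf 1\boldsymbol x^\top\le\mathbf 0$. $\mathcal C_{\mathrm{LP}}(n)$ is defined by (i) and (iii) only. Problem $\mathcal R^{\mathrm o}_{\mathrm{SDP}}$: minimize $\frac18\big\langle\mathbf D,\sum_{k=1}^K\frac1{n_k}(\mathbf M^k+\mathbf 1\mathbf 1^\top+\boldsymbol x^k\mathbf 1^\top+\mathbf 1(\boldsymbol x^k)^\top)\big\rangle$ subject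 to $(\boldsymbol x^k,\mathbf M^k)\in\mathcal C_{\mathrm{SDP}}(n_k)$ for $k=0,\dots,K$ and $\sum_{k=0}^K\boldsymbol x^k=(1-K)\mathbf 1$. Problem $\mathcal R^{\mathrm o}_{\mathrm{LP}}$ is obtained from $\mathcal R^{\mathrm o}_{\mathrm{SDP}}$ by replacing $\mathcal C_{\mathrm{SDP}}(n_k)$ with $\mathcal C_{\mathrm{LP}}(n_k)$ for all $k=0,\dots,K$. *)

(* Defs.v *)
From HB Require Import structures.
From mathcomp Require Import all_boot all_order all_algebra.
From mathcomp Require Import all_classical all_reals.
Set Implicit Arguments.
Unset Strict Implicit.
Unset Printing Implicit Defensive.
Import Order.TTheory GRing.Theory Num.Theory.
Local Open Scope classical_set_scope.
Local Open Scope ring_scope.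

(* "v = min { f t | t in F }"; in particular the minimum is attained. *)
Definition is_min (R : realType) (T : Type) (F : set T) (f : T -> R) (v : R) :
  Prop := (f @` F) v /\ lbound (f @` F) v.

Section MatrixNotions.
Variable R : realType.

(* The library norm on matrices is the sup norm, hence this definition. *)
Definition enorm (d : nat) (v : 'cV[R]_d) : R :=
  Num.sqrt (\sum_(l < d) v l 0 ^+ 2).

Definition sqdist_mx (N d : nat) (xi : 'I_N -> 'cV[R]_d) : 'M[R]_N :=
  \matrix_(i, j) enorm (xi i - xi j) ^+ 2.

Definition mxinner (N : nat) (A B : 'M[R]_N) : R := \tr (A *m B).

Definition ones (N : nat) : 'cV[R]_N := const_mx 1.

Definition diagv (N : nat) (A : 'M[R]_N) : 'cV[R]_N := \col_i A i i.

Definition psd (N : nat) (A : 'M[R]_N) : Prop :=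
  A \is symmetricmx /\ forall v : 'cV[R]_N, 0 <= (v^T *m A *m v) 0 0.

Definition loewner_ge (N : nat) (A B : 'M[R]_N) : Prop := psd (A - B).

Definition ele_le (N : nat) (A B : 'M[R]_N) : Prop :=
  forall i j, A i j <= B i j.

End MatrixNotions.

Section Problems.
Variables (R : realType) (N K : nat).

Local Notation one := (@ones R N).

(* 2n - N may be negative, hence a subtraction in R and not in nat. *)
Definition card_shift (n : nat) : R := 2 * n%:R - N%:R.

Definition C_affine (n : nat) (x : 'cV[R]_N) (M : 'M[R]_N) : Prop :=
  [/\ one^T *m x = (card_shift n)%:M,
      M *m one = card_shift n *: x &
      diagv M = one].

Definition C_psd (x : 'cV[R]_N) (M : 'M[R]_N) : Prop :=
  loewner_ge M (x *m x^T).

Definition C_ineq (x : 'cV[R]_N) (M : 'M[R]_N) : Prop :=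
  [/\ ele_le 0 (M + one *m one^T + x *m one^T + one *m x^T),
      ele_le 0 (M + one *m one^T - x *m one^T - one *m x^T),
      ele_le (M - one *m one^T + x *m one^T - one *m x^T) 0 &
      ele_le (M - one *m one^T - x *m one^T + one *m x^T) 0].

Definition C_SDP (n : nat) : set ('cV[R]_N * 'M[R]_N) :=
  [set p | [/\ p.2 \is symmetricmx, C_affine n p.1 p.2, C_psd p.1 p.2 &
               C_ineq p.1 p.2]].

Definition C_LP (n : nat) : set ('cV[R]_N * 'M[R]_N) :=
  [set p | [/\ p.2 \is symmetricmx, C_affine n p.1 p.2 & C_ineq p.1 p.2]].

(* Clusters are indexed by 'I_K.+1; index ord0 is the outlier cluster. *)
Variables (D : 'M[R]_N) (n : 'I_K.+1 -> nat).

Definition P_var : Type :=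
  ('I_K.+1 -> 'I_N -> bool) * ('I_K.+1 -> 'I_N -> 'I_N -> R).

Definition P_feasible : set P_var :=
  [set v : P_var | let: (pi, eta) := v in
    [/\ forall k i j, 0 <= eta k i j,
        forall k, (\sum_(i < N) pi k i)%N = n k,
        forall i, (\sum_(k < K.+1) pi k i)%N = 1%N &
        forall k i j, (pi k i)%:R + (pi k j)%:R - 1 <= eta k i j]].

Definition P_obj (v : P_var) : R :=
  2^-1 * \sum_(k < K.+1 | k != ord0)
           (n k)%:R^-1 * \sum_(i < N) \sum_(j < N) D i j * v.2 k i j.

Definition R_var : Type := 'I_K.+1 -> 'cV[R]_N * 'M[R]_N.

Definition R_feasible (C : nat -> set ('cV[R]_N * 'M[R]_N)) : set R_var :=
  [set z : R_var | (forall k, C (n k) (z k)) /\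
    \sum_(k < K.+1) (z k).1 = (1 - K%:R) *: one].

Definition R_obj (z : R_var) : R :=
  8^-1 * mxinner D (\sum_(k < K.+1 | k != ord0)
    (n k)%:R^-1 *: ((z k).2 + one *m one^T + (z k).1 *m one^T
                    + one *m (z k).1^T)).

End Problems.

(* Main.v *)
(* An assignment pi lifts to x^k = 2 pi^k - 1 and M^k = x^k (x^k)^T. This point
   is SDP-feasible, and since (1 + x^k_i)(1 + x^k_j) = 4 pi^k_i pi^k_j its
   objective is that of P^o at eta^k_ij = pi^k_i pi^k_j, the best eta for pi
   because D >= 0. Hence min SDP <= min P, and P^o reduces to a minimum over the
   finitely many assignments.
   The minima of the relaxations exist by compactness: with diag M = 1, the
   inequalities (iii) confine all entries of x and M to [-1, 1], and every
   constraint is closed in these entries. *)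
Require Import Defs.
From HB Require Import structures.
From mathcomp Require Import all_boot all_order all_algebra.
From mathcomp Require Import all_classical all_reals.
From mathcomp Require Import topology normedtype derive.
From mathcomp Require Import lra.
Set Implicit Arguments.
Unset Strict Implicit.
Unset Printing Implicit Defensive.
Import Order.TTheory GRing.Theory Num.Theory.
Import numFieldNormedType.Exports.
Local Open Scope classical_set_scope.
Local Open Scope ring_scope.

(** * Continuity of matrix expressions and closedness of matrix constraints *)

Section EntrywiseContinuity.
Variables (T : topologicalType) (R : realType).

(** Continuity is asked of each entry separately, so that every constraint reduces to real-valued
    functions and no topology on matrices is involved. *)
Definition mx_continuous m n (A : T -> 'M[R]_(m, n)) : Prop :=
  forall i j, continuous (fun t => A t i j).

Lemma mulrl_continuous (c : R) (f : T -> R) :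
  continuous f -> continuous (fun t => c * f t).
Proof. by move=> cf t; apply: continuousM; [exact: cvg_cst|exact: cf]. Qed.

Lemma mx_continuous_cst m n (A : 'M[R]_(m, n)) : mx_continuous (fun=> A).
Proof. by move=> i j t; exact: cvg_cst. Qed.

Lemma mx_continuousD m n (A B : T -> 'M[R]_(m, n)) :
  mx_continuous A -> mx_continuous B -> mx_continuous (fun t => A t + B t).
Proof.
move=> cA cB i j t; under eq_fun do rewrite mxE.
exact: continuousD (cA i j t) (cB i j t).
Qed.

Lemma mx_continuousN m n (A : T -> 'M[R]_(m, n)) :
  mx_continuous A -> mx_continuous (fun t => - A t).
Proof.
by move=> cA i j t; under eq_fun do rewrite mxE; exact: continuousN (cA i j t).
Qed.

Lemma mx_continuousM m n p (A : T -> 'M[R]_(m, n)) (B : T -> 'M[R]_(n, p)) :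
  mx_continuous A -> mx_continuous B -> mx_continuous (fun t => A t *m B t).
Proof.
move=> cA cB i j; under eq_fun do rewrite mxE.
apply: (@continuous_big _ _ +%R 0 xpredT); first exact: add_continuous.
by move=> k _ t; exact: continuousM (cA i k t) (cB k j t).
Qed.

Lemma mx_continuousZ m n (c : R) (A : T -> 'M[R]_(m, n)) :
  mx_continuous A -> mx_continuous (fun t => c *: A t).
Proof.
move=> cA; under eq_fun do rewrite -mul_scalar_mx.
by apply: mx_continuousM => //; exact: mx_continuous_cst.
Qed.

Lemma mx_continuous_tr m n (A : T -> 'M[R]_(m, n)) :
  mx_continuous A -> mx_continuous (fun t => (A t)^T).
Proof. by move=> cA i j; under eq_fun do rewrite mxE; exact: cA. Qed.

Lemma mx_continuous_sum (I : Type) (r : seq I) (P : pred I) m n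
    (A : I -> T -> 'M[R]_(m, n)) :
  (forall k, mx_continuous (A k)) ->
  mx_continuous (fun t => \sum_(k <- r | P k) A k t).
Proof.
move=> cA i j; under eq_fun do rewrite summxE.
apply: (@continuous_big _ _ +%R 0 P); first exact: add_continuous.
by move=> k _; exact: cA.
Qed.

Lemma mx_continuous_diagv n (A : T -> 'M[R]_n) :
  mx_continuous A -> mx_continuous (fun t => diagv (A t)).
Proof. by move=> cA i j; under eq_fun do rewrite mxE; exact: cA. Qed.

Lemma mxinner_continuous n (D : 'M[R]_n) (A : T -> 'M[R]_n) :
  mx_continuous A -> continuous (fun t => mxinner D (A t)).
Proof.
move=> cA; rewrite /mxinner /mxtrace.
apply: (@continuous_big _ _ +%R 0 xpredT); first exact: add_continuous.
by move=> k _; apply: mx_continuousM => //; exact: mx_continuous_cst.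
Qed.

Lemma closed_and (P Q : set T) :
  closed P -> closed Q -> closed [set t | P t /\ Q t].
Proof. exact: closedI. Qed.

Lemma closed_forall (I : Type) (P : I -> set T) :
  (forall i, closed (P i)) -> closed [set t | forall i, P i t].
Proof.
move=> cP; rewrite (_ : [set t | _] = \bigcap_i P i).
  by apply: closed_bigI => i _; exact: cP.
by apply/seteqP; split=> t /= Pt i; [move=> _|]; exact: Pt.
Qed.

Lemma closed_ele_le n (A B : T -> 'M[R]_n) : mx_continuous A ->
  mx_continuous B -> closed [set t | ele_le (A t) (B t)].
Proof.
move=> cA cB; apply: closed_forall => i; apply: closed_forall => j.
rewrite [X in closed X](_ : _ = (fun t => (B t + - A t) i j) @^-1` [set x | 0 <= x]).
  apply: preimage_closed; last exact: closed_ge.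
  by move=> t _; apply: mx_continuousD => //; exact: mx_continuousN.
by apply/seteqP; split=> t; rewrite /= !mxE subr_ge0.
Qed.

Lemma closed_eq_mx m n (A B : T -> 'M[R]_(m, n)) : mx_continuous A ->
  mx_continuous B -> closed [set t | A t = B t].
Proof.
move=> cA cB.
rewrite (_ : [set t | _] = [set t | forall i j, (A t + - B t) i j = 0]).
  apply: closed_forall => i; apply: closed_forall => j.
  apply: (@preimage_closed _ _ (fun t => (A t + - B t) i j) [set x | x = 0]).
    by move=> t _; apply: mx_continuousD => //; exact: mx_continuousN.
  exact: closed_eq.
apply/seteqP; split=> t /= => [-> i j|AB]; first by rewrite !mxE subrr.
by apply/matrixP => i j; apply/eqP; rewrite -subr_eq0 -(AB i j) !mxE.
Qed.

Lemma symmetricmxE n (A : 'M[R]_n) : (A \is symmetricmx) = (A == A^T).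
Proof. by rewrite is_hermitianmxE expr0 scale1r map_mx_id. Qed.

Lemma closed_symmetricmx n (A : T -> 'M[R]_n) : mx_continuous A ->
  closed [set t | A t \is symmetricmx].
Proof.
move=> cA; rewrite (_ : [set t | _] = [set t | A t = (A t)^T]).
  by apply: closed_eq_mx => //; exact: mx_continuous_tr.
by apply/seteqP; split=> t /=; rewrite symmetricmxE => /eqP.
Qed.

(** For fixed [v] the quadratic form is linear in the matrix, so its nonnegativity is a closed
    condition, and closedness survives the intersection over all [v]. *)
Lemma closed_psd n (A : T -> 'M[R]_n) : mx_continuous A ->
  closed [set t | psd (A t)].
Proof.
move=> cA; apply: closed_and; first exact: closed_symmetricmx.
apply: closed_forall => v.
apply: (@preimage_closed _ _ (fun t => (v^T *m A t *m v) 0 0) [set x | 0 <= x]).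
  by move=> t _; do 2?apply: mx_continuousM => //; exact: mx_continuous_cst.
exact: closed_ge.
Qed.

End EntrywiseContinuity.

(* Dispatch on the syntax of the goal: trying the lemmas in turn diverges in
   unification. *)
#[local] Ltac mxcont := lazymatch goal with
  | H : mx_continuous ?A |- mx_continuous ?A => exact: H
  | |- mx_continuous (fun=> ?A) => exact: mx_continuous_cst
  | |- mx_continuous (fun t => @?A t + @?B t) =>
      apply: (@mx_continuousD _ _ _ _ A B); mxcont
  | |- mx_continuous (fun t => - @?A t) =>
      apply: (@mx_continuousN _ _ _ _ A); mxcont
  | |- mx_continuous (fun t => @?A t *m @?B t) =>
      apply: (@mx_continuousM _ _ _ _ _ A B); mxcont
  | |- mx_continuous (fun t => ?c *: @?A t) =>
      apply: (@mx_continuousZ _ _ _ _ c A); mxcont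
  | |- mx_continuous (fun t => (@?A t)^T) =>
      apply: (@mx_continuous_tr _ _ _ _ A); mxcont
  | |- mx_continuous (fun t => diagv (@?A t)) =>
      apply: (@mx_continuous_diagv _ _ _ A); mxcont
  | H : mx_continuous _ |- _ => exact: H
  end.

(** * Existence of minima for the two relaxations *)

Section Relaxations.
Variables (R : realType) (N K : nat).
Local Notation one := (@ones R N).

Section ClosedConstraints.
Variables (T : topologicalType) (x : T -> 'cV[R]_N) (M : T -> 'M[R]_N).
Hypotheses (cx : mx_continuous x) (cM : mx_continuous M).

Lemma closed_C_affine n : closed [set t | C_affine n (x t) (M t)].
Proof.
rewrite (_ : [set t | _] = [set t | one^T *m x t = (card_shift R N n)%:M /\
    (M t *m one = card_shift R N n *: x t /\ diagv (M t) = one)]).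
  by apply: closed_and; [|apply: closed_and]; apply: closed_eq_mx; mxcont.
by apply/seteqP; split=> t /= => [[]|[? []]].
Qed.

Lemma closed_C_psd : closed [set t | C_psd (x t) (M t)].
Proof. by apply: closed_psd; mxcont. Qed.

Lemma closed_C_ineq : closed [set t | C_ineq (x t) (M t)].
Proof.
rewrite (_ : [set t | _] = [set t |
  (ele_le 0 (M t + one *m one^T + x t *m one^T + one *m (x t)^T) /\
   ele_le 0 (M t + one *m one^T - x t *m one^T - one *m (x t)^T)) /\
  (ele_le (M t - one *m one^T + x t *m one^T - one *m (x t)^T) 0 /\
   ele_le (M t - one *m one^T - x t *m one^T + one *m (x t)^T) 0)]).
  by do 2?apply: closed_and; apply: closed_ele_le; mxcont.
by apply/seteqP; split=> t /= => [[]|[[? ?] []]].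
Qed.

Lemma closed_C_LP n : closed [set t | C_LP n (x t, M t)].
Proof.
rewrite (_ : [set t | _] = [set t | M t \is symmetricmx /\
    (C_affine n (x t) (M t) /\ C_ineq (x t) (M t))]).
  apply: closed_and; first exact: closed_symmetricmx.
  by apply: closed_and; [exact: closed_C_affine|exact: closed_C_ineq].
by apply/seteqP; split=> t /= => [[]|[? []]].
Qed.

(** Through this splitting the SDP set inherits closedness and bounds from the LP set. *)
Lemma C_SDP_LP n p : C_SDP n p <-> @C_LP R N n p /\ C_psd p.1 p.2.
Proof. by split=> [[]|[[]]]. Qed.

Lemma closed_C_SDP n : closed [set t | C_SDP n (x t, M t)].
Proof.
rewrite (_ : [set t | _] =
    [set t | C_LP n (x t, M t) /\ C_psd (x t) (M t)]).
  by apply: closed_and; [exact: closed_C_LP|exact: closed_C_psd].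
by apply/seteqP; split=> t /= /C_SDP_LP.
Qed.

End ClosedConstraints.

(** At [(i, i)], where [M i i = 1], the first two inequalities read [2 + 2 x_i >= 0] and
    [2 - 2 x_i >= 0]. At any [(i, j)] the sum of the first two gives [M i j >= -1], and the sum of
    the last two gives [M i j <= 1]. *)
Lemma C_LP_bounded n x M : @C_LP R N n (x, M) ->
  (forall i, -1 <= x i 0 <= 1) /\ (forall i j, -1 <= M i j <= 1).
Proof.
case=> _ [_ _ dM] [h1 h2 h3 h4] /=.
have e i j : (one *m one^T) i j = 1 by rewrite !mxE big_ord1 !mxE mulr1.
have ex i j : (x *m one^T) i j = x i 0 by rewrite !mxE big_ord1 !mxE mulr1.
have exT i j : (one *m x^T) i j = x j 0 by rewrite !mxE big_ord1 !mxE mul1r.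
have Mii i : M i i = 1 by move/matrixP/(_ i 0): dM; rewrite !mxE.
have entry A i j : (- A : 'M[R]_N) i j = - A i j by rewrite mxE.
have entryD A B i j : (A + B : 'M[R]_N) i j = A i j + B i j by rewrite mxE.
have entry0 i j : (0 : 'M[R]_N) i j = 0 by rewrite mxE.
split=> [i|i j].
  move: (h1 i i) (h2 i i); rewrite !(entryD, entry, e, ex, exT, Mii, entry0).
  by move=> *; lra.
move: (h1 i j) (h2 i j) (h3 i j) (h4 i j).
rewrite !(entryD, entry, e, ex, exT, entry0).
by move=> *; lra.
Qed.

(** One real coordinate per entry: [inl i] for the vector and [inr (i, j)] for the matrix of cluster
    [k]. A candidate thus becomes a point of a product of copies of [R], where Tychonoff's theorem
    applies; symmetry of the matrices remains a constraint. *)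
Let coord : eqType := ('I_K.+1 * ('I_N + 'I_N * 'I_N))%type.
Let coords : topologicalType := prod_topology (fun _ : coord => R).

Definition of_coords (w : coords) : R_var R N K :=
  fun k => (\col_i w (k, inl i), \matrix_(i, j) w (k, inr (i, j))).

Lemma of_coords_surj (z : R_var R N K) : exists w, of_coords w = z.
Proof.
exists (fun c => match c.2 with
                 | inl i => (z c.1).1 i 0
                 | inr ij => (z c.1).2 ij.1 ij.2
                 end).
apply/funext => k; rewrite /of_coords (surjective_pairing (z k)) /=.
by congr pair; [apply/colP => i|apply/matrixP => i j]; rewrite mxE.
Qed.

Lemma of_coords1_continuous k : mx_continuous (fun w => (of_coords w k).1).
Proof.
move=> i j; under eq_fun do rewrite mxE.
exact: (@proj_continuous coord (fun=> R) (k, inl i)).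
Qed.

Lemma of_coords2_continuous k : mx_continuous (fun w => (of_coords w k).2).
Proof.
move=> i j; under eq_fun do rewrite mxE.
exact: (@proj_continuous coord (fun=> R) (k, inr (i, j))).
Qed.

Variables (D : 'M[R]_N) (n : 'I_K.+1 -> nat).

Lemma R_obj_continuous : continuous (fun w => R_obj D n (of_coords w)).
Proof.
apply: mulrl_continuous; apply: mxinner_continuous.
apply: mx_continuous_sum => k.
have c1 := @of_coords1_continuous k; have c2 := @of_coords2_continuous k.
mxcont.
Qed.

(** In coordinates the feasible set is a closed part of the cube with sides [[-1, 1]], hence
    compact, and the extreme value theorem applies. Keeping [C] abstract below [C_LP] serves both
    relaxations at once. *)
Lemma R_min_exists (C : nat -> set ('cV[R]_N * 'M[R]_N)) :
  (forall m, C m `<=` C_LP m) ->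
  (forall m k, closed [set w | C m (of_coords w k)]) ->
  R_feasible n C !=set0 -> exists v, is_min (R_feasible n C) (R_obj D n) v.
Proof.
move=> CLP closedC [z0 Fz0]; pose A := [set w | R_feasible n C (of_coords w)].
have A0 : A !=set0.
  by have [w0 w0E] := of_coords_surj z0; exists w0; rewrite /A /= w0E.
have clA : closed A.
  apply: closed_and; first by apply: closed_forall => k; exact: closedC.
  apply: closed_eq_mx; last exact: mx_continuous_cst.
  by apply: mx_continuous_sum => k; exact: of_coords1_continuous.
have cptA : compact A.
  have cptB := @tychonoff coord (fun=> R) (fun=> `[-1, 1]%classic)
    (fun=> @segment_compact R (-1) 1).
  apply: (subclosed_compact clA cptB) => w [Cw _] [k [i|[i j]]] /=;
  rewrite in_itv /=.
  - by have [/(_ i)] := C_LP_bounded (CLP _ _ (Cw k)); rewrite mxE.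
  - by have [_ /(_ i j)] := C_LP_bounded (CLP _ _ (Cw k)); rewrite mxE.
have [|w /set_mem Aw minw] := @compact_EVT_min _ _
    (fun w => R_obj D n (of_coords w)) A A0 cptA.
  by apply: continuous_subspaceT; exact: R_obj_continuous.
exists (R_obj D n (of_coords w)); split; first by exists (of_coords w).
(* Every competitor [z] has coordinates, so the minimum over [A] bounds its objective too. *)
move=> _ [z Fz <-]; have [w' w'E] := of_coords_surj z.
by rewrite -w'E; apply: minw; rewrite inE /A /= w'E.
Qed.

End Relaxations.

(** * Cluster assignments and their lifts *)

Section Assignments.
Variables (R : realType) (N K : nat) (n : 'I_K.+1 -> nat).
Local Notation one := (@ones R N).

(** A boolean predicate on a finite function type, so that a minimizing assignment can be picked by
    [arg_minP]. *)
Definition is_assignment (pi : {ffun 'I_K.+1 * 'I_N -> bool}) : bool :=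
  [forall k, \sum_(i < N) pi (k, i) == n k]%N &&
  [forall i, \sum_(k < K.+1) pi (k, i) == 1]%N.

(** The disjoint union [S] offers [n k] slots in each cluster [k], [N] slots in all. Enumerating [S]
    gives each point its own slot, and the tag of the slot is the cluster of the point. *)
Lemma assignment_exists :
  (\sum_(k < K.+1) n k)%N = N -> exists pi, is_assignment pi.
Proof.
move=> sum_n; pose S := {k : 'I_K.+1 & 'I_(n k)}.
have cardS : N = #|{: S}|.
  rewrite card_tagged -[LHS]sum_n sumnE big_map big_enum.
  by apply: eq_bigr => k _; rewrite card_ord.
exists [ffun c => tag (enum_val (cast_ord cardS c.2)) == c.1].
apply/andP; split; apply/forallP; [move=> k|move=> i]; apply/eqP.
  under eq_bigr do rewrite ffunE /=.
  have bij : bijective (fun i => enum_val (cast_ord cardS i)).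
    by apply: bij_comp; [exact: enum_val_bij|exact: (Bijective (cast_ordK _) (cast_ordKV _))].
  (* The sum over points becomes a sum over slots and is then split by cluster: cluster [k]
     contributes [n k] ones, every other cluster zeros. *)
  rewrite -(reindex _ (onW_bij _ bij) (P := xpredT)
    (F := fun u : S => nat_of_bool (tag u == k))) /=.
  rewrite -(sig_big_dep xpredT (fun _ _ => true)
    (fun l (_ : 'I_(n l)) => nat_of_bool (l == k))) /= (bigD1 k) //=.
  rewrite eqxx sum1_card card_ord big1 ?addn0// => l /negPf lk.
  by rewrite lk big1.
under eq_bigr do rewrite ffunE /= eq_sym.
set l := tag _; rewrite (bigD1 l) //= eqxx big1// => k /negPf ->.
by [].
Qed.

Definition lift_eta (pi : 'I_K.+1 -> 'I_N -> bool) : P_var R N K :=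
  (pi, fun k i j => (pi k i && pi k j)%:R).

Definition lift_R (pi : 'I_K.+1 -> 'I_N -> bool) : R_var R N K :=
  fun k => let x := \col_i (2 * (pi k i)%:R - 1) in (x, x *m x^T).

Lemma lift_eta_feasible (pi : 'I_K.+1 -> 'I_N -> bool) :
  (forall k, (\sum_(i < N) pi k i)%N = n k) ->
  (forall i, (\sum_(k < K.+1) pi k i)%N = 1%N) ->
  P_feasible n (lift_eta pi).
Proof.
move=> pin pi1; split=> // k i j /=.
by case: (pi k i); case: (pi k j) => /=; lra.
Qed.

(** For binary values the product of [pi k i] and [pi k j] is the maximum of 0 and
    [pi k i + pi k j - 1], the two lower bounds on [eta k i j]; all coefficients of the objective
    are nonnegative. *)
Lemma lift_eta_le (D : 'M[R]_N) v : (forall i j, 0 <= D i j) ->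
  P_feasible n v -> P_obj D n (lift_eta v.1) <= P_obj D n v.
Proof.
case: v => pi eta D0 [/= eta0 _ _ eta_ge].
rewrite /P_obj ler_pM2l ?invr_gt0 ?ltr0n//; apply: ler_sum => k _.
apply: ler_wpM2l; first by rewrite invr_ge0.
apply: ler_sum => i _; apply: ler_sum => j _; apply: ler_wpM2l => //=.
move: (eta0 k i j) (eta_ge k i j).
by case: (pi k i); case: (pi k j) => /=; lra.
Qed.

(** The minimizer is delivered as a lifted assignment, the form that can be compared with the SDP
    relaxation. *)
Lemma P_min_exists (D : 'M[R]_N) : (\sum_(k < K.+1) n k)%N = N ->
  (forall i j, 0 <= D i j) ->
  exists pi, P_feasible n (lift_eta pi) /\
    is_min (P_feasible n) (P_obj D n) (P_obj D n (lift_eta pi)).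
Proof.
move=> sum_n D0; have [pi0 pi0P] := assignment_exists sum_n.
pose cur (pi : {ffun 'I_K.+1 * 'I_N -> bool}) k i := pi (k, i).
pose F pi := P_obj D n (lift_eta (cur pi)).
case: (arg_minP F pi0P) => pi /andP[/forallP pin /forallP pi1] pi_min.
have Fpi : P_feasible n (lift_eta (cur pi)).
  by apply: lift_eta_feasible => [k|i]; apply/eqP; [exact: pin|exact: pi1].
exists (cur pi); split=> //; split; first by exists (lift_eta (cur pi)).
move=> _ [v Fv <-]; apply: le_trans (lift_eta_le D0 Fv).
have -> : v.1 = cur [ffun c => v.1 c.1 c.2].
  by apply/funext => k; apply/funext => i; rewrite /cur ffunE.
apply: pi_min; case: v Fv => p eta [_ /= pn p1 _].
apply/andP; split; apply/forallP; [move=> k|move=> i]; apply/eqP.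
  by rewrite -[RHS]pn; apply: eq_bigr => i _; rewrite ffunE.
by rewrite -[RHS](p1 i); apply: eq_bigr => k _; rewrite ffunE.
Qed.

(** Each [x_i] is 1 or -1, so the diagonal of [x *m x^T] is 1, and the inequalities are sign
    conditions on products such as [(1 + x_i)(1 + x_j) >= 0] and [(x_i - 1)(x_j + 1) <= 0]. The
    semidefinite constraint holds with difference 0. *)
Lemma lift_R_feasible pi : P_feasible n (lift_eta pi) ->
  R_feasible n (@C_SDP R N) (lift_R pi).
Proof.
case=> [_ /= pin pi1 _]; split=> [k|]; last first.
  (* There are [K + 1] clusters and point [i] lies in exactly one, so the entry is
     [2 - (K + 1) = 1 - K]. *)
  apply/colP => i; rewrite summxE !mxE mulr1.
  under eq_bigr do rewrite mxE.
  rewrite sumrB -mulr_sumr -natr_sum pi1 sumr_const card_ord -natr1.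
  by lra.
rewrite /lift_R /=; set x := \col_i _.
have x1 : one^T *m x = (card_shift R N (n k))%:M.
  apply/matrixP => a b; rewrite !ord1 !mxE eqxx mulr1n /card_shift.
  under eq_bigr do rewrite !mxE mul1r.
  by rewrite sumrB -mulr_sumr -natr_sum pin sumr_const card_ord.
split=> /=.
- by rewrite symmetricmxE trmx_mul trmxK.
- split=> //.
    (* Associativity leaves [x^T *m one], the transpose of the scalar computed in [x1]. *)
    by rewrite -mulmxA -[one]trmxK -trmx_mul x1 tr_scalar_mx mul_mx_scalar.
  apply/colP => i; rewrite !mxE big_ord1 !mxE.
  by case: (pi k i) => /=; lra.
- rewrite /C_psd /loewner_ge subrr; split.
    by rewrite symmetricmxE trmx0.
  by move=> v; rewrite mulmx0 mul0mx mxE.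
- by split=> i j; rewrite !mxE !big_ord1 !mxE;
    case: (pi k i); case: (pi k j) => /=; lra.
Qed.

Lemma lift_R_obj (D : 'M[R]_N) pi :
  R_obj D n (lift_R pi) = P_obj D n (lift_eta pi).
Proof.
rewrite /R_obj /P_obj /mxinner mulmx_sumr raddf_sum /= !mulr_sumr.
apply: eq_bigr => k _.
rewrite -scalemxAr mxtraceZ mulrCA [RHS]mulrCA; congr (_ * _).
rewrite /mxtrace !mulr_sumr; apply: eq_bigr => i _.
(* The trace pairs [D i j] with the entry at [(j, i)], and the lifted matrix is symmetric; its
   factor 4 turns the weight 1/8 into 1/2. *)
rewrite mxE !mulr_sumr; apply: eq_bigr => j _.
rewrite !mxE !big_ord1 !mxE.
by case: (pi k i); case: (pi k j) => /=; lra.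
Qed.

End Assignments.

(** * Comparison of the three minima *)

Theorem theorem4 (R : realType) (N d K : nat) (xi : 'I_N -> 'cV[R]_d)
  (n : 'I_K.+1 -> nat)
  (n_gt0 : forall k : 'I_K.+1, k != ord0 -> (0 < n k)%N)
  (sum_n : (\sum_(k < K.+1) n k)%N = N) :
  let D := sqdist_mx xi in
  exists vLP vSDP vP : R,
    [/\ is_min (R_feasible n (@C_LP R N)) (R_obj D n) vLP,
        is_min (R_feasible n (@C_SDP R N)) (R_obj D n) vSDP,
        is_min (P_feasible n) (P_obj D n) vP &
        vLP <= vSDP <= vP].
Proof.
move=> D; have D0 i j : 0 <= D i j by rewrite mxE sqr_ge0.
have [pi [Fpi minP]] := P_min_exists sum_n D0.
have Fz := lift_R_feasible Fpi.
have SDP_LP z : R_feasible n (@C_SDP R N) z -> R_feasible n (@C_LP R N) z.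
  by case=> Cz sum_z; split=> // k; have [] := (C_SDP_LP _ _).1 (Cz k).
have [|||vSDP minSDP] := @R_min_exists R N K D n (@C_SDP R N).
- by move=> m p /C_SDP_LP[].
- move=> m k; apply: closed_C_SDP.
    exact: of_coords1_continuous.
  exact: of_coords2_continuous.
- by exists (lift_R R pi).
have [|||vLP minLP] := @R_min_exists R N K D n (@C_LP R N).
- by move=> m p.
- move=> m k; apply: closed_C_LP.
    exact: of_coords1_continuous.
  exact: of_coords2_continuous.
- by exists (lift_R R pi); exact: SDP_LP.
exists vLP, vSDP, (P_obj D n (lift_eta R pi)); split=> //; apply/andP; split.
  (* An SDP minimizer is LP-feasible, and the objective is the same. *)
  have [[z Fz' <-] _] := minSDP.
  by apply: minLP.2; exists z => //; exact: SDP_LP.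
(* The lift of an optimal assignment is an SDP candidate of value [vP]. *)
by apply: minSDP.2; exists (lift_R R pi) => //; exact: lift_R_obj.
Qed.
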